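(* Let $\mathcal{H}$ be a two-dimensional Hilbert space and, for $\varepsilon\in[0,1]$, let $\mathcal{D}_\varepsilon$ be the depolarizing noise $\mathcal{D}_\varepsilon(\rho)=(1-\varepsilon)\rho+\varepsilon\frac{1}{2}\mathrm{tr}\rho$. Consider two-outcome protocols $\{(\mathcal{I}_\omega,\mathcal{C}_\omega)\}_{\omega=1,2}$, where $\{\mathcal{I}_1,\mathcal{I}_2\}$ is a CP instrument (each $\mathcal{I}_\omega$ completely positive on $\mathcal{L}(\mathcal{H})$ with $\mathcal{I}_1+\mathcal{I}_2$ trace-preserving) and $\mathcal{C}_1,\mathcal{C}_2$ are trace-preserving completely positive maps on $\mathcal{L}(\mathcal{H})$, with average fidelity $$\bar F=\int_{\|\ket{\psi}\|=1} d\psi\, \Big\langle\psi\Big|\sum_{\omega=1}^2\mathcal{C}_\omega\circ\mathcal{D}_\varepsilon\circ\mathcal{I}_\omega(\ket{\psi}\bra{\psi})\Big|\psi\Big\rangle,$$ where $d\psi$ is the uniform probability measure on the unit sphere of $\mathcal{H}$. Then the protocols maximizing $\bar F$ are as follows. (i) If $\varepsilon\le 2/3$, the ''do nothing'' protocol $\mathcal{I}_\omega=p_\omega\,\mathrm{id}$ (with $p_\omega\ge0$, $p_1+p_2=1$), $\mathcal{C}_\omega=\mathrm{id}$ for $\omega=1,2$, is optimal, and the optimal average fidelity is $1-\varepsilon/2$. (ii) If $\varepsilon\ge 2/3$, the ''discriminate and reprepare'' protocol $\mathcal{I}_\omega(\rho)=\ket{\phi_\omega}\bra{\phi_\omega}\rho\ket{\phi_\omega}\bra{\phi_\omega}$,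 $\mathcal{C}_\omega(\rho)=\ket{\phi_\omega}\bra{\phi_\omega}\mathrm{tr}\rho$ for $\omega=1,2$, where $\{\ket{\phi_1},\ket{\phi_2}\}$ is an arbitrary orthonormal basis of $\mathcal{H}$, is optimal, and the optimal average fidelity is $2/3$.
   Context: $\mathcal{L}(\mathcal{H})$ denotes the linear operators on $\mathcal{H}$ and $\mathrm{id}$ the identity map on $\mathcal{L}(\mathcal{H})$. *)

(* Defs.v *)
From HB Require Import structures.
From mathcomp Require Import all_boot all_order all_algebra.
From mathcomp Require Import all_classical all_reals all_analysis.
From mathcomp.real_closed Require Import complex.
Set Implicit Arguments. Unset Strict Implicit. Unset Printing Implicit Defensive.
Import Order.TTheory GRing.Theory Num.Theory.
Local Open Scope ring_scope.
Local Open Scope complex_scope.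

Section Qubit.
Variable R : realType.
Local Notation C := R[i].

Definition op := 'M[C]_2.
Definition superop := op -> op.

Definition adjmx (m n : nat) (A : 'M[C]_(m, n)) : 'M[C]_(n, m) :=
  map_mx (@conjc R) A^T.

Definition is_linear_map (Phi : superop) : Prop :=
  forall (a : C) (X Y : op), Phi (a *: X + Y) = a *: Phi X + Phi Y.

(* Positive semidefiniteness of an n x n block matrix Y with 2 x 2 blocks
   (an element of M_n(L(H)) = L(C^n (x) H)):  <v, Y v> >= 0 for all v. *)
Definition block_psd (n : nat) (Y : 'I_n -> 'I_n -> op) : Prop :=
  forall v : 'I_n -> 'cV[C]_2,
    0 <= \sum_(i < n) \sum_(j < n) (adjmx (v i) *m Y i j *m v j) 0 0.

Definition completely_positive (Phi : superop) : Prop :=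
  is_linear_map Phi /\
  forall (n : nat) (Y : 'I_n -> 'I_n -> op),
    block_psd Y -> block_psd (fun i j => Phi (Y i j)).

Definition trace_preserving (Phi : superop) : Prop :=
  forall X : op, \tr (Phi X) = \tr X.

Definition is_channel (Phi : superop) : Prop :=
  completely_positive Phi /\ trace_preserving Phi.

Definition is_instrument (I1 I2 : superop) : Prop :=
  completely_positive I1 /\ completely_positive I2 /\
  trace_preserving (fun X => I1 X + I2 X).

Definition is_protocol (I1 I2 C1 C2 : superop) : Prop :=
  is_instrument I1 I2 /\ is_channel C1 /\ is_channel C2.

Definition depol (eps : R) : superop :=
  fun rho => ((1 - eps)%:C : C) *: rho + ((eps / 2)%:C * \tr rho) *: (1%:M : op).

Definition ketbra (u v : 'cV[C]_2) : op := u *m adjmx v.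

Definition fid_at (Phi : superop) (psi : 'cV[C]_2) : C :=
  (adjmx psi *m Phi (ketbra psi psi) *m psi) 0 0.

Definition expi (t : R) : C := (cos t) +i* (sin t).
Definition hopf (eta xi1 xi2 : R) : 'cV[C]_2 :=
  \col_(k < 2) (if k == ord0 then (cos eta)%:C * expi xi1
                else (sin eta)%:C * expi xi2).

(* Integral against the uniform (unitarily invariant) probability measure on
   the unit sphere of C^2 (= S^3), written in Hopf coordinates where the
   surface measure is sin(eta) cos(eta) d eta d xi1 d xi2, total mass 2 pi^2. *)
Definition sphere_avg (f : 'cV[C]_2 -> R) : R :=
  (2 * pi ^+ 2)^-1 *
  \int[@lebesgue_measure R]_(eta in `[0, pi / 2]%classic)
   \int[@lebesgue_measure R]_(xi1 in `[0, 2 * pi]%classic)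
    \int[@lebesgue_measure R]_(xi2 in `[0, 2 * pi]%classic)
      (sin eta * cos eta * f (hopf eta xi1 xi2)).

(* average fidelity of the protocol {(I_w, C_w)}_{w=1,2} under D_eps
   (the integrand is real for valid protocols; we take its real part) *)
Definition avg_fidelity (eps : R) (I1 I2 C1 C2 : superop) : R :=
  sphere_avg (fun psi =>
    complex.Re (fid_at (fun rho => C1 (depol eps (I1 rho))
                                   + C2 (depol eps (I2 rho))) psi)).

Definition orthonormal2 (phi1 phi2 : 'cV[C]_2) : Prop :=
  (adjmx phi1 *m phi1) 0 0 = 1 /\ (adjmx phi2 *m phi2) 0 0 = 1 /\
  (adjmx phi1 *m phi2) 0 0 = 0.

End Qubit.

(* Main.v *)
Require Import Defs.
From HB Require Import structures.
From mathcomp Require Import all_boot all_order all_algebra.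
From mathcomp Require Import all_classical all_reals all_analysis.
From mathcomp.real_closed Require Import complex.
From mathcomp Require Import ring lra.
Import Order.TTheory GRing.Theory Num.Theory.
Import numFieldNormedType.Exports.
Set Implicit Arguments.
Unset Strict Implicit.
Unset Printing Implicit Defensive.
Local Open Scope ring_scope.
Local Open Scope complex_scope.

(** For a linear map Phi let [supertrace Phi] be its trace as an operator on
    L(H).  Averaging over the sphere gives
    F = (tr Phi(1) + supertrace Phi) / 6.  With
      s = sum_w supertrace (C_w o I_w)   and   t = sum_w tr I_w(C_w(1)),
    the fidelity of a protocol is (2 + (1 - eps) s + (eps / 2) t) / 6, and
    everything follows from s <= 4, t <= 4 and s + t <= 6.  The last bound says
    that depolarizing noise at eps = 2/3 is "measure, then prepare": the six
    eigenvectors |k> of the Pauli matrices satisfy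
    sum_k <k|X|k> |k><k| = X + tr X, while the supertrace of X |-> m(X) S is
    m(S), so s + t = sum_w sum_k <k|I_w(C_w(|k><k|))|k>, where the
    inequality S <= (tr S) 1 for positive S bounds each term. *)

(** * Integration over the sphere in Hopf coordinates *)

(** Hypotheses on the whole line yield the one-sided limits at the endpoints at no cost; the
    integrands below are smooth everywhere. *)
Lemma Rintegral_FTC2 (R : realType) (F f : R -> R) (a b : R) :
  a < b -> (forall x : R, is_derive x 1 F (f x)) ->
  (forall x : R, derivable f x 1) ->
  \int[@lebesgue_measure R]_(x in `[a, b]%classic) f x = F b - F a.
Proof.
move=> ab dF df; rewrite /Rintegral (@continuous_FTC2 _ _ F) //.
- by apply: derivable_within_continuous => x _.
- have cF x : {for x, continuous F}.
    exact/differentiable_continuous/derivable1_diffP.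
  split => [x _||] //; first exact: cvg_at_right_filter (cF a).
  exact: cvg_at_left_filter (cF b).
- by move=> x _; rewrite derive1E derive_val.
Qed.

Lemma Rintegral_cst_itv (R : realType) (a b r : R) : a < b ->
  \int[@lebesgue_measure R]_(x in `[a, b]%classic) r = r * (b - a).
Proof.
move=> ab; rewrite mulrBr.
apply: (@Rintegral_FTC2 _ (fun x => r * x)) => // x.
by apply: is_derive_eq; rewrite /GRing.scale /=; ring.
Qed.

(** Over a period, first harmonics and the mixed product average to 0 and squares to 1/2; the shift
    [t] drops out by periodicity. *)
Lemma Rintegral_trig_period (R : realType) (k t a0 a1 a2 a3 a4 a5 : R) :
  \int[@lebesgue_measure R]_(x in `[0, 2 * pi]%classic)
    (k * (a0 + a1 * cos (x - t) + a2 * sin (x - t) + a3 * cos (x - t) ^+ 2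
      + a4 * (cos (x - t) * sin (x - t)) + a5 * sin (x - t) ^+ 2))
  = k * (2 * pi * a0 + pi * (a3 + a5)).
Proof.
pose c (x : R) := cos (x - t); pose s (x : R) := sin (x - t).
have dc (x : R) : is_derive x 1 c (- s x).
  by rewrite /c; apply: is_derive_eq; rewrite /s /GRing.scale /=; ring.
have ds (x : R) : is_derive x 1 s (c x).
  by rewrite /s; apply: is_derive_eq; rewrite /c /GRing.scale /=; ring.
pose F x := k * (a0 * x + a1 * s x - a2 * c x + a3 * ((x + s x * c x) / 2)
  + a4 * (s x ^+ 2 / 2) + a5 * ((x - s x * c x) / 2)).
transitivity (F (2 * pi) - F 0).
  apply: (@Rintegral_FTC2 _ F) => [|x|x].
  - by rewrite mulr_gt0 ?pi_gt0.
  - rewrite /F -/(c _) -/(s _); apply: is_derive_eq; rewrite /GRing.scale /=.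
    have cc : c x * c x = 1 - s x * s x.
      by rewrite -!expr2 /c /s -(cos2Dsin2 (x - t)); ring.
    by rewrite !(expr2, mulrN) cc; field.
  - exact: ex_derive.
rewrite /F.
have -> : c (2 * pi) = c 0 by rewrite /c !cosB mulr_natl cos2pi sin2pi cos0 sin0.
have -> : s (2 * pi) = s 0 by rewrite /s !sinB mulr_natl cos2pi sin2pi cos0 sin0.
by field.
Qed.

(* A fidelity depends on the phases only through xi2 - xi1, and quadratically;
   after integrating over them, only the terms without first harmonics stay. *)
Lemma sphere_avg_trig (R : realType) (f : 'cV[R[i]]_2 -> R)
    (a b d q0 q1 q2 : R) (p1 p2 : R -> R) :
  (forall eta xi1 xi2, f (hopf eta xi1 xi2) =
     a * cos eta ^+ 4 + b * (cos eta ^+ 2 * sin eta ^+ 2) + d * sin eta ^+ 4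
     + p1 eta * cos (xi2 - xi1) + p2 eta * sin (xi2 - xi1)
     + cos eta ^+ 2 * sin eta ^+ 2 *
       (q0 * cos (xi2 - xi1) ^+ 2 + q1 * (cos (xi2 - xi1) * sin (xi2 - xi1))
        + q2 * sin (xi2 - xi1) ^+ 2)) ->
  sphere_avg f = (a + d) / 3 + (b + (q0 + q2) / 2) / 6.
Proof.
move=> fE; rewrite /sphere_avg.
(* The coefficient of cos^2 sin^2 in eta once the relative phase is averaged. *)
pose e := b + (q0 + q2) / 2.
have pi0 : pi != 0 :> R by rewrite gt_eqF ?pi_gt0.
transitivity ((2 * pi ^+ 2)^-1 *
    \int[@lebesgue_measure R]_(x in `[0, pi / 2]%classic)
      (4 * pi ^+ 2 * (sin x * cos x *
        (a * cos x ^+ 4 + e * (cos x ^+ 2 * sin x ^+ 2) + d * sin x ^+ 4)))).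
  congr (_ * _); apply: eq_Rintegral => x _.
  transitivity (\int[@lebesgue_measure R]_(xi1 in `[0, 2 * pi]%classic)
     (2 * pi * (sin x * cos x *
       (a * cos x ^+ 4 + e * (cos x ^+ 2 * sin x ^+ 2) + d * sin x ^+ 4)))).
    apply: eq_Rintegral => t _.
    under eq_Rintegral => y _.
      rewrite fE.
      rewrite (_ : _ * _ = sin x * cos x *
       ((a * cos x ^+ 4 + b * (cos x ^+ 2 * sin x ^+ 2) + d * sin x ^+ 4)
       + p1 x * cos (y - t) + p2 x * sin (y - t)
       + cos x ^+ 2 * sin x ^+ 2 * q0 * cos (y - t) ^+ 2
       + cos x ^+ 2 * sin x ^+ 2 * q1 * (cos (y - t) * sin (y - t))
       + cos x ^+ 2 * sin x ^+ 2 * q2 * sin (y - t) ^+ 2)); last by ring.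
      over.
    by rewrite Rintegral_trig_period /e; field.
  by rewrite Rintegral_cst_itv ?mulr_gt0 ?pi_gt0//; ring.
(* Antiderivatives of sin cos^5, sin^3 cos^3 and sin^5 cos. On [0, pi/2] they contribute 1/6, 1/12
   and 1/6, and normalization leaves a factor 2. *)
pose F (x : R) := 4 * pi ^+ 2 * (a * (- cos x ^+ 6 / 6)
  + e * (sin x ^+ 4 / 4 - sin x ^+ 6 / 6) + d * (sin x ^+ 6 / 6)).
have -> : \int[@lebesgue_measure R]_(x in `[0, pi / 2]%classic)
      (4 * pi ^+ 2 * (sin x * cos x *
        (a * cos x ^+ 4 + e * (cos x ^+ 2 * sin x ^+ 2) + d * sin x ^+ 4)))
    = F (pi / 2) - F 0.
  apply: (@Rintegral_FTC2 _ F) => [|x|x].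
  - by rewrite divr_gt0 ?pi_gt0.
  - apply: is_derive_eq; rewrite /GRing.scale /=.
    have cc : cos x ^+ 2 = 1 - sin x ^+ 2 by rewrite -(cos2Dsin2 x); ring.
    by rewrite cc; field.
  - exact: ex_derive.
rewrite /F sin_pihalf cos_pihalf sin0 cos0 /e; move: pi pi0 => p p0.
by field.
Qed.

(** * Positive maps and the supertrace on 2 x 2 matrices *)

Lemma sum_ord2 (V : nmodType) (F : 'I_2 -> V) : \sum_(i < 2) F i = F 0 + F 1.
Proof.
by rewrite big_ord_recl big_ord1; congr (_ + F _); apply: val_inj.
Qed.

Lemma linear_delta (K : comNzRingType) (V : lmodType K) (m n : nat)
    (f : 'M[K]_(m, n) -> V) : linear f ->
  forall X, f X = \sum_i \sum_j X i j *: f (delta_mx i j).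
Proof.
move=> lf X.
(* Linearity is a hypothesis on a bare function here; packing it makes the theory of bundled linear
   maps applicable. *)
pose L : {linear 'M[K]_(m, n) -> V} :=
  HB.pack f (GRing.isLinear.Build K 'M[K]_(m, n) V *:%R f lf).
rewrite -[f]/(L : _ -> _) [in LHS](matrix_sum_delta X) linear_sum.
apply: eq_bigr => i _; rewrite linear_sum.
by apply: eq_bigr => j _; rewrite linearZ.
Qed.

Definition expect {R : realType} (v : 'cV[R[i]]_2) (X : op R) : R[i] :=
  (adjmx v *m X *m v) 0 0.

Lemma braketE {R : realType} (u v : 'cV[R[i]]_2) (X : op R) :
  (adjmx u *m X *m v) 0 0
    = conjc (u 0 0) * X 0 0 * v 0 0 + conjc (u 0 0) * X 0 1 * v 1 0
    + conjc (u 1 0) * X 1 0 * v 0 0 + conjc (u 1 0) * X 1 1 * v 1 0.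
Proof. by rewrite /adjmx !mxE sum_ord2 !mxE !sum_ord2 !mxE; ring. Qed.

Lemma expectE {R : realType} (v : 'cV[R[i]]_2) (X : op R) :
  expect v X
    = conjc (v 0 0) * X 0 0 * v 0 0 + conjc (v 0 0) * X 0 1 * v 1 0
    + conjc (v 1 0) * X 1 0 * v 0 0 + conjc (v 1 0) * X 1 1 * v 1 0.
Proof. exact: braketE. Qed.

Lemma expect_linear {R : realType} (v : 'cV[R[i]]_2) :
  linear (expect v : op R -> R[i]^o).
Proof. by move=> a X Y; rewrite !expectE !mxE /GRing.scale /=; ring. Qed.

Lemma mxtrace2 (K : nmodType) (X : 'M[K]_2) : \tr X = X 0 0 + X 1 1.
Proof. exact: sum_ord2. Qed.

Lemma ketbraE {R : realType} (u v : 'cV[R[i]]_2) i j :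
  ketbra u v i j = u i 0 * conjc (v j 0).
Proof. by rewrite /ketbra /adjmx !mxE big_ord1 !mxE. Qed.

(** * The Pauli eigenvectors as a 2-design *)

Definition ket2 {R : realType} (a b : R[i]) : 'cV[R[i]]_2 :=
  \col_k (if k == ord0 then a else b).

Lemma ket2_0 {R : realType} (a b : R[i]) : ket2 a b 0 0 = a.
Proof. by rewrite mxE. Qed.

Lemma ket2_1 {R : realType} (a b : R[i]) : ket2 a b 1 0 = b.
Proof. by rewrite mxE. Qed.

(** A named constant, generalized in the long computations to a variable known only through its
    square, -1. *)
Definition imag {R : realType} : R[i] := 'i.

(* The eigenvectors of the three Pauli matrices; they form a 2-design. *)
Definition design {R : realType} : seq 'cV[R[i]]_2 :=
  let h : R[i] := ((Num.sqrt 2)^-1)%:C in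
  [:: ket2 1 0; ket2 0 1; ket2 h h; ket2 h (- h); ket2 h (h * imag);
      ket2 h (- h * imag)].

Lemma sqr_sqrt2V {R : realType} : (((Num.sqrt (2:R))^-1)%:C : R[i]) ^+ 2 = 2^-1.
Proof.
rewrite -rmorphXn /= exprVn sqr_sqrtr ?ler0n// fmorphV /=.
by rewrite rmorph_nat.
Qed.

Lemma conjcM {R : realType} (x y : R[i]) : conjc (x * y) = conjc x * conjc y.
Proof. exact: rmorphM. Qed.

Lemma conjcN {R : realType} (x : R[i]) : conjc (- x) = - conjc x.
Proof. exact: rmorphN. Qed.

Lemma conjc_i {R : realType} : conjc ('i : R[i]) = - 'i.
Proof. by simpc. Qed.

Lemma matrix2P (T : Type) (X Y : 'M[T]_2) :
  X 0 0 = Y 0 0 -> X 0 1 = Y 0 1 -> X 1 0 = Y 1 0 -> X 1 1 = Y 1 1 -> X = Y.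
Proof.
move=> h00 h01 h10 h11; apply/matrixP => i j.
have ord2 (k : 'I_2) : (k = 0) \/ (k = 1).
  by case: k => [[|[|]]] // hk; [left|right]; apply: val_inj.
by case: (ord2 i) => ->; case: (ord2 j) => ->.
Qed.

(** The 2-design property: the sum of the squares |k><k| (x) |k><k| is 1 + SWAP, and contracting one
    factor with X gives X + tr X. The proof compares entries. *)
Lemma design_sum {R : realType} (X : op R) :
  \sum_(k <- design) expect k X *: ketbra k k = X + \tr X *: 1%:M.
Proof.
rewrite /design; set h : R[i] := ((Num.sqrt 2)^-1)%:C; set w : R[i] := imag.
have hc : conjc h = h by rewrite conjc_real.
have wc : conjc w = - w by apply: conjc_i.
(* Each term from the four superposition states carries h^4, which this relation removes at the
   end. *)
have h4 : 4 * h ^+ 4 = 1.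
  by rewrite (exprM h 2 2) sqr_sqrt2V; field.
have ww : w ^+ 2 = -1 by exact: sqr_i.
rewrite !big_cons big_nil mxtrace2.
(* [P] is made opaque, known only by its entries, so that [mxE] leaves it alone. *)
pose P k := ketbra k k : op R.
have PE k i j : P k i j = k i 0 * conjc (k j 0) by exact: ketbraE.
rewrite -!/(P _).
move: P PE => P PE; apply: matrix2P.
all: rewrite !mxE !PE.
all: rewrite !expectE !(ket2_0, ket2_1) ?mulr1n ?mulr0n.
all: rewrite !(conjcM, conjcN, conjc0, conjc1, wc, hc) ?mulr1n ?mulr0n.
all: move: h4 ww; clear; move: h w => h w h4 ww.
- by transitivity (X 0 0 + 4 * h ^+ 4 * (X 0 0 + X 1 1)); [ring : ww|rewrite h4; ring].
- by transitivity (4 * h ^+ 4 * X 0 1); [ring : ww|rewrite h4; ring].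
- by transitivity (4 * h ^+ 4 * X 1 0); [ring : ww|rewrite h4; ring].
- by transitivity (X 1 1 + 4 * h ^+ 4 * (X 0 0 + X 1 1)); [ring : ww|rewrite h4; ring].
Qed.

(** * Positive semidefinite operators and positive maps *)

Definition psd {R : realType} (X : op R) : Prop := forall v, 0 <= expect v X.

Definition positive_map {R : realType} (Phi : superop R) : Prop :=
  linear Phi /\ forall X, psd X -> psd (Phi X).

(** The case of a single block, n = 1. *)
Lemma positive_map_of_cp {R : realType} (Phi : superop R) :
  completely_positive Phi -> positive_map Phi.
Proof.
move=> [lPhi cp]; split=> // X psdX v.
have := cp 1 (fun _ _ => X) _ (fun=> v).
by rewrite !big_ord1; apply=> u; rewrite !big_ord1; apply: psdX.
Qed.

(* In dimension 2, <v|tr X - X|v> = <w|X|w> with w orthogonal to v and of the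
   same norm. *)
Lemma psd_tr_sub {R : realType} (X : op R) : psd X -> psd (\tr X *: 1%:M - X).
Proof.
move=> psdX v.
have := psdX (ket2 (- conjc (v 1 0)) (conjc (v 0 0))).
rewrite !expectE !ket2_0 !ket2_1 conjcN !conjcK; congr (0 <= _).
by rewrite !mxE mxtrace2 ?mulr1n ?mulr0n; ring.
Qed.

Lemma psd_tr_ge0 {R : realType} (X : op R) : psd X -> 0 <= \tr X.
Proof.
move=> psdX; have := addr_ge0 (psdX (ket2 1 0)) (psdX (ket2 0 1)).
rewrite !expectE !ket2_0 !ket2_1 mxtrace2 conjc0 conjc1; congr (0 <= _).
by ring.
Qed.

Lemma psd_ketbra {R : realType} (k : 'cV[R[i]]_2) : psd (ketbra k k).
Proof.
move=> v; have := mulcJ_ge0 (conjc (v 0 0) * k 0 0 + conjc (v 1 0) * k 1 0).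
rewrite expectE !ketbraE rmorphD /= !conjcM !conjcK; congr (0 <= _); ring.
Qed.

Lemma tr_ketbra {R : realType} (k : 'cV[R[i]]_2) :
  \tr (ketbra k k) = expect k 1%:M.
Proof.
by rewrite expectE mxtrace2 !ketbraE !mxE ?mulr1n ?mulr0n; ring.
Qed.

Lemma tr_ketbra_design {R : realType} (k : 'cV[R[i]]_2) :
  k \in design -> \tr (ketbra k k) = 1.
Proof.
rewrite mxtrace2 !ketbraE /design; set h : R[i] := ((Num.sqrt 2)^-1)%:C.
have hc : conjc h = h by rewrite conjc_real.
have wc : conjc imag = - imag :> R[i] by apply: conjc_i.
have hh : h * h = 2^-1 by rewrite -expr2 sqr_sqrt2V.
have ww : imag * imag = -1 :> R[i] by rewrite -expr2; exact: sqr_i.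
rewrite !inE => /or4P[| | |/or3P[| |]];
  move=> /eqP ->; rewrite !ket2_0 !ket2_1 ?(conjcM, conjcN, conjc0, conjc1, hc, wc);
  rewrite ?mulNr ?mulrN ?opprK ?(mulrACA h imag) ?hh ?ww; try by field.
Qed.

(* The trace of Phi as an operator on L(H), i.e. four times its entanglement
   fidelity. *)
Definition supertrace {R : realType} (Phi : superop R) : R[i] :=
  \sum_i \sum_j Phi (delta_mx i j) i j.

Lemma supertraceD {R : realType} (Phi Psi : superop R) :
  supertrace (fun X => Phi X + Psi X) = supertrace Phi + supertrace Psi.
Proof.
rewrite /supertrace -big_split; apply: eq_bigr => i _.
by rewrite -big_split; apply: eq_bigr => j _; rewrite mxE.
Qed.

Lemma supertraceZ {R : realType} a (Phi : superop R) :
  supertrace (fun X => a *: Phi X) = a * supertrace Phi.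
Proof.
rewrite /supertrace mulr_sumr; apply: eq_bigr => i _.
by rewrite mulr_sumr; apply: eq_bigr => j _; rewrite mxE.
Qed.

Lemma eq_supertrace {R : realType} (Phi Psi : superop R) :
  Phi =1 Psi -> supertrace Phi = supertrace Psi.
Proof. by move=> /funext ->. Qed.

(** The map is a rank-one operator on L(H), whose trace is the functional [m] at the vector [S];
    expanding [S] in matrix units shows it termwise. *)
Lemma supertrace_measure_prepare {R : realType} (m : op R -> R[i]) (S : op R) :
  scalar m -> supertrace (fun X => m X *: S) = m S.
Proof.
move=> lm; rewrite (linear_delta (V := R[i]^o) lm S).
by apply: eq_bigr => i _; apply: eq_bigr => j _; rewrite mxE mulrC.
Qed.

Lemma linear_sumE {K : nzRingType} (U V : lmodType K) (f : U -> V) (I : Type)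
    (r : seq I) (F : I -> U) : linear f ->
  f (\sum_(i <- r) F i) = \sum_(i <- r) f (F i).
Proof.
move=> lf; pose L : {linear U -> V} := HB.pack f (GRing.isLinear.Build K U V *:%R f lf).
exact: (linear_sum L).
Qed.

Lemma linearDE {K : nzRingType} (U V : lmodType K) (f : U -> V) (x y : U) :
  linear f -> f (x + y) = f x + f y.
Proof. by move=> lf; rewrite -[x]scale1r lf !scale1r. Qed.

Lemma linear0E {K : nzRingType} (U V : lmodType K) (f : U -> V) :
  linear f -> f 0 = 0.
Proof.
by move=> lf; have := linear_sumE [::] (fun i : nat => 0) lf; rewrite !big_nil.
Qed.

Lemma linearZE {K : nzRingType} (U V : lmodType K) (f : U -> V) a (x : U) :
  linear f -> f (a *: x) = a *: f x.
Proof. by move=> lf; rewrite -[a *: x]addr0 lf linear0E// addr0. Qed.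

Lemma linear_subE {K : nzRingType} (U V : lmodType K) (f : U -> V) (x y : U) :
  linear f -> f (x - y) = f x - f y.
Proof. by move=> lf; rewrite addrC -scaleN1r lf scaleN1r addrC. Qed.

(** Positivity of [Phi] is applied to (tr S) 1 - S, which is positive in dimension 2. *)
Lemma positive_map_le_tr {R : realType} (Phi : superop R) (S : op R) v :
  positive_map Phi -> psd S ->
  expect v (Phi S) <= \tr S * expect v (Phi 1%:M).
Proof.
move=> [lPhi pPhi] psdS; have := pPhi _ (psd_tr_sub psdS) v.
rewrite linear_subE// linearZE// linear_subE; last exact: expect_linear.
by rewrite linearZE ?subr_ge0//; exact: expect_linear.
Qed.

Lemma positive_map_tr_le_tr {R : realType} (Phi : superop R) (S : op R) :
  positive_map Phi -> psd S -> \tr (Phi S) <= \tr S * \tr (Phi 1%:M).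
Proof.
move=> [lPhi pPhi] psdS; have := psd_tr_ge0 (pPhi _ (psd_tr_sub psdS)).
by rewrite linear_subE// linearZE// raddfB /= mxtraceZ subr_ge0.
Qed.

Lemma psd1 {R : realType} : psd (1%:M : op R).
Proof.
move=> v; have := addr_ge0 (mulcJ_ge0 (conjc (v 0 0))) (mulcJ_ge0 (conjc (v 1 0))).
rewrite expectE !mxE !conjcK ?mulr1n ?mulr0n; congr (0 <= _); ring.
Qed.

Lemma expect_comp_linear {R : realType} (Phi : superop R) v :
  linear Phi -> scalar (fun X => expect v (Phi X)).
Proof. by move=> lPhi a X Y; rewrite lPhi; apply: (expect_linear v). Qed.

(* Up to the factor 3, the left-hand side is the supertrace of C o D o I with D
   the depolarizing noise at eps = 2/3. *)
Lemma supertrace_comp_design {R : realType} (I C : superop R) :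
  linear I -> linear C ->
  supertrace (fun X => C (I X)) + \tr (I (C 1%:M))
    = \sum_(k <- design) expect k (I (C (ketbra k k))).
Proof.
move=> lI lC.
(* The trace term is the supertrace of the part of the noise that discards its input and prepares
   the identity. *)
have -> : \tr (I (C 1%:M)) = supertrace (fun X => \tr (I X) *: C 1%:M).
  rewrite (supertrace_measure_prepare (m := fun X => \tr (I X)))// => a X Y.
  by rewrite lI mxtraceD mxtraceZ.
rewrite -supertraceD.
transitivity (\sum_(k <- design)
    supertrace (fun X => expect k (I X) *: C (ketbra k k))); last first.
  apply: eq_bigr => k _.
  rewrite (supertrace_measure_prepare (m := fun X => expect k (I X)))//.
  exact: expect_comp_linear.
transitivity (supertrace (fun X =>
    \sum_(k <- design) expect k (I X) *: C (ketbra k k))).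
  (* C(I X) + tr(I X) C(1) is C applied to the design identity at I X. *)
  apply: eq_supertrace => X; rewrite -linearZE// -linearDE// -design_sum.
  by rewrite linear_sumE//; apply: eq_bigr => k _; rewrite linearZE.
rewrite /supertrace [RHS]exchange_big /=; apply: eq_bigr => i _.
rewrite [RHS]exchange_big /=; apply: eq_bigr => j _.
by rewrite summxE.
Qed.

(** Taking traces in the design identity gives tr X + 2 tr X. *)
Lemma sum_expect_design {R : realType} (X : op R) :
  \sum_(k <- design) expect k X = 3 * \tr X.
Proof.
have := congr1 mxtrace (design_sum X).
rewrite raddf_sum mxtraceD mxtraceZ mxtrace1 /=.
under eq_big_seq => k kd do rewrite mxtraceZ tr_ketbra_design// mulr1.
by move=> ->; ring.
Qed.

(** Each C(|k><k|) is positive of trace 1, so its design term is at most <k|I(1)|k>; these sum to 3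
    tr I(1). *)
Lemma supertrace_comp_le {R : realType} (I C : superop R) :
  positive_map I -> positive_map C -> trace_preserving C ->
  supertrace (fun X => C (I X)) + \tr (I (C 1%:M)) <= 3 * \tr (I 1%:M).
Proof.
move=> pI pC tC; have [lI _] := pI; have [lC psdC] := pC.
rewrite supertrace_comp_design//.
rewrite -sum_expect_design big_seq [leRHS]big_seq; apply: ler_sum => k kd.
apply: (le_trans (positive_map_le_tr k pI _)).
  by apply: psdC; exact: psd_ketbra.
by rewrite tC tr_ketbra_design// mul1r.
Qed.

(** The previous bound with I = id and C = Phi reads supertrace Phi + 2 <= 6. *)
Lemma supertrace_le4 {R : realType} (Phi : superop R) :
  positive_map Phi -> trace_preserving Phi -> supertrace Phi <= 4.
Proof.
move=> pPhi tPhi.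
have pid : positive_map (id : superop R) by split.
have := supertrace_comp_le pid pPhi tPhi.
by rewrite /= tPhi mxtrace1 (_ : 3 * 2%:R = 4 + 2) ?lerD2r//; ring.
Qed.

(** * The average fidelity *)

Lemma fid_atE {R : realType} (Phi : superop R) v :
  fid_at Phi v = expect v (Phi (ketbra v v)).
Proof. by []. Qed.

(** The projector |v><v| ignores the phase, and the outer expectation picks up only |u|^2 = 1. *)
Lemma fid_at_phase {R : realType} (Phi : superop R) (u : R[i]) v :
  u * conjc u = 1 -> fid_at Phi (u *: v) = fid_at Phi v.
Proof.
move=> uu; rewrite !fid_atE.
have -> : ketbra (u *: v) (u *: v) = ketbra v v.
  apply/matrixP => i j; rewrite !ketbraE !mxE conjcM mulrACA.
  by rewrite uu mul1r.
rewrite !expectE !mxE !conjcM.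
transitivity (u * conjc u * expect v (Phi (ketbra v v))).
  by rewrite expectE; ring.
by rewrite uu mul1r expectE.
Qed.

(** Extracting the global phase leaves only the relative phase [xi2 - xi1]. *)
Lemma hopfE {R : realType} (eta xi1 xi2 : R) :
  hopf eta xi1 xi2 = expi xi1 *:
    ket2 (cos eta)%:C ((sin eta)%:C * expi (xi2 - xi1)).
Proof.
apply/matrixP => i j; rewrite !mxE; case: ifP => _; first exact: mulrC.
rewrite mulrCA; congr (_ * _); rewrite /expi cosB sinB; simpc.
have := cos2Dsin2 xi1; move: (cos xi1) (sin xi1) (cos xi2) (sin xi2).
move=> c1 s1 c2 s2 e; apply/eqP; rewrite eq_complex /=; apply/andP; split; apply/eqP.
  by transitivity ((c1 ^+ 2 + s1 ^+ 2) * c2); [rewrite e mul1r|ring].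
by transitivity ((c1 ^+ 2 + s1 ^+ 2) * s2); [rewrite e mul1r|ring].
Qed.

Lemma ReD {R : realType} (x y : R[i]) :
  complex.Re (x + y) = complex.Re x + complex.Re y.
Proof. by case: x y => [? ?] [? ?]. Qed.

Lemma ReMl {R : realType} (r : R) (x : R[i]) :
  complex.Re (r%:C * x) = r * complex.Re x.
Proof. by case: x => a b /=; rewrite mul0r subr0. Qed.

(** Brings the fidelity to the form integrated by [sphere_avg_trig], with [k], [l] the cosine and
    sine of the relative phase. The coefficients of k^2 and l^2 are opposite, since both come from
    the second harmonic, so they cancel in the average. *)
Lemma fid_at_ket2 {R : realType} (Phi : superop R) (c s k l : R) :
  linear Phi -> k ^+ 2 + l ^+ 2 = 1 ->
  let Q00 := Phi (delta_mx 0 0) in let Q01 := Phi (delta_mx 0 1) in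
  let Q10 := Phi (delta_mx 1 0) in let Q11 := Phi (delta_mx 1 1) in
  complex.Re (fid_at Phi (ket2 c%:C (s%:C * (k +i* l)))) =
    complex.Re (Q00 0 0) * c ^+ 4
    + complex.Re (Q00 1 1 + Q11 0 0 + Q01 0 1 + Q10 1 0)
      * (c ^+ 2 * s ^+ 2)
    + complex.Re (Q11 1 1) * s ^+ 4
    + (c ^+ 3 * s * complex.Re (Q00 0 1 + Q10 0 0 + Q00 1 0 + Q01 0 0)
      + c * s ^+ 3 * complex.Re (Q11 0 1 + Q10 1 1 + Q11 1 0 + Q01 1 1))
      * k
    + (c ^+ 3 * s * complex.Re
        (imag * (Q00 0 1 + Q10 0 0 - Q00 1 0 - Q01 0 0))
      + c * s ^+ 3 * complex.Re
        (imag * (Q11 0 1 + Q10 1 1 - Q11 1 0 - Q01 1 1))) * l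
    + c ^+ 2 * s ^+ 2 * (complex.Re (Q01 1 0 + Q10 0 1) * k ^+ 2
      + complex.Re (imag * 2 * (Q10 0 1 - Q01 1 0)) * (k * l)
      + - complex.Re (Q01 1 0 + Q10 0 1) * l ^+ 2).
Proof.
move=> lPhi kl Q00 Q01 Q10 Q11.
rewrite fid_atE (linear_delta lPhi (ketbra _ _)) !sum_ord2 -/Q00 -/Q01 -/Q10 -/Q11.
set v := ket2 _ _; rewrite !ketbraE; clearbody Q00 Q01 Q10 Q11.
have v0 : v 0 0 = c%:C by exact: ket2_0.
have v1 : v 1 0 = s%:C * (k%:C + imag * l%:C).
  by rewrite /v ket2_1; congr (_ * _); rewrite /imag; simpc.
have wc : conjc (k%:C + imag * l%:C) = k%:C - imag * l%:C.
  by rewrite /imag; simpc.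
have kl' : k%:C ^+ 2 = 1 - l%:C ^+ 2 :> R[i].
  by rewrite -!rmorphXn /= -[1]/(1%:C) -rmorphB -kl addrK.
have ii : imag ^+ 2 = -1 :> R[i] by exact: sqr_i.
rewrite expectE v0 v1 !conjcM !conjc_real wc; clear v0 v1 wc; clearbody v.
rewrite !mxE.
(* Real factors are collected before fixed complex numbers, so that the real part can be taken term
   by term. *)
transitivity (complex.Re ((c ^+ 4)%:C * Q00 0 0
    + (c ^+ 2 * s ^+ 2)%:C * (Q00 1 1 + Q11 0 0 + Q01 0 1 + Q10 1 0)
    + (s ^+ 4)%:C * Q11 1 1
    + (c ^+ 3 * s * k)%:C * (Q00 0 1 + Q10 0 0 + Q00 1 0 + Q01 0 0)
    + (c * s ^+ 3 * k)%:C * (Q11 0 1 + Q10 1 1 + Q11 1 0 + Q01 1 1)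
    + (c ^+ 3 * s * l)%:C
      * (imag * (Q00 0 1 + Q10 0 0 - Q00 1 0 - Q01 0 0))
    + (c * s ^+ 3 * l)%:C
      * (imag * (Q11 0 1 + Q10 1 1 - Q11 1 0 - Q01 1 1))
    + (c ^+ 2 * s ^+ 2 * (k ^+ 2 - l ^+ 2))%:C * (Q01 1 0 + Q10 0 1)
    + (c ^+ 2 * s ^+ 2 * (k * l))%:C * (imag * 2 * (Q10 0 1 - Q01 1 0)))).
  congr complex.Re; rewrite !(rmorphM (real_complex R)) !(rmorphB (real_complex R)).
  rewrite ?(rmorphM (real_complex R)) /=.
  move: imag ii => w ww.
  move: (Q00 0 0) (Q00 0 1) (Q00 1 0) (Q00 1 1) => a00 a01 a02 a03.
  move: (Q01 0 0) (Q01 0 1) (Q01 1 0) (Q01 1 1) => a10 a11 a12 a13.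
  move: (Q10 0 0) (Q10 0 1) (Q10 1 0) (Q10 1 1) => a20 a21 a22 a23.
  move: (Q11 0 0) (Q11 0 1) (Q11 1 0) (Q11 1 1) => a30 a31 a32 a33.
  move: (c%:C) (s%:C) (k%:C) (l%:C) kl' => C S K L KL; clear -KL ww.
  ring : KL ww.
rewrite !(ReD, ReMl); do ![move: (complex.Re _) => ?].
by ring.
Qed.

(** The surviving coefficients give (2 (a + d) + b) / 6: the entries in [a] and [d] occur in both
    the trace and the supertrace, the four in [b] in just one of them. *)
Lemma sphere_avg_fid {R : realType} (Phi : superop R) : linear Phi ->
  sphere_avg (fun psi => complex.Re (fid_at Phi psi))
    = complex.Re (\tr (Phi 1%:M) + supertrace Phi) / 6.
Proof.
move=> lPhi; have fid_hopf eta xi1 xi2 : fid_at Phi (hopf eta xi1 xi2)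
    = fid_at Phi (ket2 (cos eta)%:C ((sin eta)%:C * expi (xi2 - xi1))).
  rewrite hopfE fid_at_phase//; apply/eqP.
  rewrite eq_complex /= mulrN opprK -!expr2 cos2Dsin2 eqxx /=.
  by apply/eqP; ring.
have fidE eta xi1 xi2 := etrans (congr1 (@complex.Re R) (fid_hopf eta xi1 xi2))
  (fid_at_ket2 (cos eta) (sin eta) lPhi (cos2Dsin2 (xi2 - xi1))).
rewrite (sphere_avg_trig fidE).
set Q00 := Phi (delta_mx 0 0); set Q01 := Phi (delta_mx 0 1).
set Q10 := Phi (delta_mx 1 0); set Q11 := Phi (delta_mx 1 1).
have trE : \tr (Phi 1%:M) = Q00 0 0 + Q00 1 1 + (Q11 0 0 + Q11 1 1).
  rewrite -!mxtrace2 -mxtraceD -linearDE//; congr (\tr (Phi _)).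
  by apply: matrix2P; rewrite !mxE /= ?addr0 ?add0r.
have sE : supertrace Phi = Q00 0 0 + Q01 0 1 + (Q10 1 0 + Q11 1 1).
  by rewrite /supertrace !sum_ord2.
rewrite trE sE; move: Q00 Q01 Q10 Q11 {fid_hopf fidE trE sE} => Q00 Q01 Q10 Q11.
move: (Q00 0 0) (Q00 1 1) (Q01 0 1) (Q10 1 0) (Q11 0 0) (Q11 1 1).
move=> a b c d e f; move: (Q01 _ _ + Q10 _ _) => g; rewrite !ReD.
move: (complex.Re a) (complex.Re b) (complex.Re c) (complex.Re d).
move: (complex.Re e) (complex.Re f) (complex.Re g) => {}e {}f {}g {}a {}b {}c {}d.
by field.
Qed.

Lemma mxtrace_depol {R : realType} (eps : R) (X : op R) :
  \tr (depol eps X) = \tr X.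
Proof.
rewrite /depol mxtraceD !mxtraceZ mxtrace1.
rewrite -(rmorph_nat (real_complex R)) mulrAC -mulrDl -rmorphM.
by rewrite -rmorphD /= divfK ?pnatr_eq0// subrK mul1r.
Qed.

Lemma depol_linear {R : realType} (eps : R) : linear (depol eps).
Proof.
move=> a X Y; rewrite /depol mxtraceD mxtraceZ.
by apply/matrixP => i j; rewrite !mxE; ring.
Qed.

Lemma Re_nat {R : realType} (n : nat) : complex.Re (n%:R : R[i]) = n%:R.
Proof. by elim: n => // n IHn; rewrite !mulrS ReD IHn. Qed.

(** The noise splits into a multiple of the identity map and a trace-and-prepare map; the latter has
    its supertrace by the measure-and-prepare formula. *)
Lemma supertrace_depol {R : realType} (eps : R) (I C : superop R) :
  linear I -> linear C ->
  supertrace (fun X => C (depol eps (I X)))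
    = (1 - eps)%:C * supertrace (fun X => C (I X))
      + (eps / 2)%:C * \tr (I (C 1%:M)).
Proof.
move=> lI lC.
have -> : \tr (I (C 1%:M)) = supertrace (fun X => \tr (I X) *: C 1%:M).
  rewrite (supertrace_measure_prepare (m := fun X => \tr (I X)))// => a X Y.
  by rewrite lI mxtraceD mxtraceZ.
rewrite -!supertraceZ -supertraceD; apply: eq_supertrace => X.
by rewrite /depol (linearDE _ _ lC) !(linearZE _ _ lC) scalerA.
Qed.

Lemma avg_fidelityE {R : realType} (eps : R) (I1 I2 C1 C2 : superop R) :
  is_protocol I1 I2 C1 C2 ->
  avg_fidelity eps I1 I2 C1 C2 =
  (2 + (1 - eps) * complex.Re (supertrace (fun X => C1 (I1 X))
                             + supertrace (fun X => C2 (I2 X)))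
     + eps / 2 * complex.Re (\tr (I1 (C1 1%:M)) + \tr (I2 (C2 1%:M)))) / 6.
Proof.
move=> [[[lI1 _] [[lI2 _] tI]] [[[lC1 _] tC1] [[lC2 _] tC2]]].
rewrite /avg_fidelity sphere_avg_fid; last first.
  move=> a X Y; rewrite lI1 lI2 !(depol_linear eps) lC1 lC2.
  by rewrite scalerDr addrACA.
rewrite mxtraceD tC1 tC2 !mxtrace_depol -mxtraceD tI mxtrace1.
rewrite supertraceD !supertrace_depol//.
move: (supertrace _) (supertrace _) (\tr _) (\tr _) => s1 s2 t1 t2.
have ReE (x y z t : R[i]) (r q : R) : complex.Re (2%:R
    + (r%:C * x + q%:C * z + (r%:C * y + q%:C * t)))
  = 2 + r * complex.Re (x + y) + q * complex.Re (z + t).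
  rewrite (ReD 2%:R) Re_nat -[in RHS]addrA; congr (_ + _).
  by rewrite addrACA -!mulrDr !ReD !ReMl !ReD.
by rewrite -ReE.
Qed.

(** For [s], the sum of the C_w o I_w is positive and trace-preserving. For [t], tr I_w(C_w(1)) <= 2
    tr I_w(1), and the tr I_w(1) add up to 2. For [s + t], the design bound is summed over w. *)
Lemma protocol_bounds {R : realType} (I1 I2 C1 C2 : superop R) :
  is_protocol I1 I2 C1 C2 ->
  let s := complex.Re (supertrace (fun X => C1 (I1 X))
                     + supertrace (fun X => C2 (I2 X))) in
  let t := complex.Re (\tr (I1 (C1 1%:M)) + \tr (I2 (C2 1%:M))) in
  [/\ s <= 4, t <= 4 & s + t <= 6].
Proof.
move=> [[/positive_map_of_cp pI1 [/positive_map_of_cp pI2 tI]]].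
move=> [[/positive_map_of_cp pC1 tC1] [/positive_map_of_cp pC2 tC2]].
(* Comparable complex numbers have equal imaginary parts, so the order passes to real parts. *)
have leRe (x y : R[i]) : x <= y -> complex.Re x <= complex.Re y.
  by rewrite lecE => /andP[].
have trI : \tr (I1 1%:M) + \tr (I2 1%:M) = 2 by rewrite -mxtraceD tI mxtrace1.
split.
- rewrite -[leRHS]Re_nat -supertraceD; apply/leRe/supertrace_le4; last first.
    by move=> X; rewrite mxtraceD tC1 tC2 -mxtraceD tI.
  have [[lI1 qI1] [lI2 qI2]] := (pI1, pI2).
  have [[lC1 qC1] [lC2 qC2]] := (pC1, pC2).
  split=> [a X Y|X psdX v]; first by rewrite lI1 lI2 lC1 lC2 scalerDr addrACA.
  have -> : expect v (C1 (I1 X) + C2 (I2 X))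
      = expect v (C1 (I1 X)) + expect v (C2 (I2 X)).
    exact: linearDE (expect_linear v).
  by rewrite addr_ge0 ?(qC1 _ (qI1 _ psdX) v) ?(qC2 _ (qI2 _ psdX) v).
- rewrite -[leRHS]Re_nat; apply: leRe.
  have le2 (I C : superop R) : positive_map I -> positive_map C ->
      trace_preserving C -> \tr (I (C 1%:M)) <= 2 * \tr (I 1%:M).
    move=> pI [_ qC] tC; rewrite -[2]/(2%:R) -(mxtrace1 _ 2) -[\tr 1%:M]tC.
    exact/positive_map_tr_le_tr/qC/psd1.
  apply: (le_trans (lerD (le2 _ _ pI1 pC1 tC1) (le2 _ _ pI2 pC2 tC2))).
  by rewrite -mulrDr trI -natrM.
- rewrite -[leRHS]Re_nat -ReD; apply: leRe; rewrite addrACA.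
  apply: (le_trans (lerD (supertrace_comp_le pI1 pC1 tC1)
                         (supertrace_comp_le pI2 pC2 tC2))).
  by rewrite -mulrDr trI -natrM.
Qed.

(** * The two optimal protocols *)

Lemma cp_scale {R : realType} (p : R) :
  0 <= p -> completely_positive (fun X : op R => p%:C *: X).
Proof.
move=> p0; split=> [a X Y|n Y psdY v]; first by rewrite scalerDr !scalerA mulrC.
have -> : \sum_(i < n) \sum_(j < n) (adjmx (v i) *m (p%:C *: Y i j) *m v j) 0 0
  = p%:C * \sum_(i < n) \sum_(j < n) (adjmx (v i) *m Y i j *m v j) 0 0.
  rewrite mulr_sumr; apply: eq_bigr => i _; rewrite mulr_sumr.
  by apply: eq_bigr => j _; rewrite -scalemxAr -scalemxAl mxE.
by rewrite mulr_ge0 ?ler0c.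
Qed.

Lemma channel_id {R : realType} : is_channel (id : superop R).
Proof. by split=> //; split. Qed.

Lemma adjmxM {R : realType} (m n p : nat) (A : 'M[R[i]]_(m, n)) (B : 'M[R[i]]_(n, p)) :
  adjmx (A *m B) = adjmx B *m adjmx A.
Proof. by rewrite /adjmx trmx_mul map_mxM. Qed.

Lemma adjmx_ketbra {R : realType} (k : 'cV[R[i]]_2) :
  adjmx (ketbra k k) = ketbra k k.
Proof.
by apply/matrixP => i j; rewrite /adjmx !mxE !big_ord1 !mxE rmorphM mulrC /= conjcK.
Qed.

(** The adjoint moves onto the test vectors, replacing v_i by A v_i. *)
Lemma cp_conj {R : realType} (A : op R) :
  completely_positive (fun X => adjmx A *m X *m A).
Proof.
split=> [a X Y|n Y psdY v].
  by rewrite mulmxDr mulmxDl -scalemxAr -scalemxAl.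
have := psdY (fun i => A *m v i); congr (0 <= _).
apply: eq_bigr => i _; apply: eq_bigr => j _.
by rewrite adjmxM !mulmxA.
Qed.

(** The Kraus operators are |j><k| for j = 0, 1: testing on v_i amounts to testing [Y] on <k|v_i>
    |j> and summing over j. *)
Lemma cp_trace_ketbra {R : realType} (k : 'cV[R[i]]_2) :
  completely_positive (fun X => \tr X *: ketbra k k).
Proof.
split=> [a X Y|n Y psdY v].
  by rewrite mxtraceD mxtraceZ scalerDl scalerA.
pose w i : R[i] := (adjmx k *m v i) 0 0.
have := addr_ge0 (psdY (fun i => ket2 (w i) 0)) (psdY (fun i => ket2 0 (w i))).
rewrite -big_split; congr (0 <= _); apply: eq_bigr => i _.
rewrite -big_split; apply: eq_bigr => j _ /=.
have wE l : w l = conjc (k 0 0) * v l 0 0 + conjc (k 1 0) * v l 1 0.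
  by rewrite /w /adjmx !mxE sum_ord2 !mxE.
clearbody w; rewrite !braketE !ket2_0 !ket2_1 conjc0 mxtrace2 !wE.
have PE a b : (((Y i j) 0 0 + (Y i j) 1 1) *: ketbra k k) a b
    = (Y i j 0 0 + Y i j 1 1) * (k a 0 * conjc (k b 0)).
  by rewrite -ketbraE mxE.
by rewrite !PE rmorphD /= !conjcM !conjcK; ring.
Qed.

Lemma ketbra_idem {R : realType} (k : 'cV[R[i]]_2) :
  (adjmx k *m k) 0 0 = 1 -> ketbra k k *m ketbra k k = ketbra k k.
Proof.
move=> k1; rewrite /ketbra mulmxA -(mulmxA k) [adjmx k *m k]mx11_scalar k1.
by rewrite mulmx1.
Qed.

Lemma mxtrace_ketbra_unit {R : realType} (k : 'cV[R[i]]_2) :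
  (adjmx k *m k) 0 0 = 1 -> \tr (ketbra k k) = 1.
Proof. by move=> k1; rewrite tr_ketbra /expect mulmx1. Qed.

(** The matrix [U] with columns [k1], [k2] has a left inverse, its adjoint; being square, it has the
    same right inverse. *)
Lemma orthonormal2_complete {R : realType} (k1 k2 : 'cV[R[i]]_2) :
  orthonormal2 k1 k2 -> ketbra k1 k1 + ketbra k2 k2 = 1%:M.
Proof.
move=> [n1 [n2 o12]].
have o21 : (adjmx k2 *m k1) 0 0 = 0.
  rewrite -[RHS]conjc0 -o12 /adjmx !mxE !sum_ord2 !mxE rmorphD /= !conjcM !conjcK.
  by rewrite mulrC [X in _ + X]mulrC.
pose U : op R := \matrix_(i, j) (if j == 0 then k1 i 0 else k2 i 0).
have UU : adjmx U *m U = 1%:M.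
  move: n1 n2 o12 o21; rewrite /adjmx !mxE !sum_ord2 !mxE => n1 n2 o12 o21.
  by apply: matrix2P; rewrite !mxE sum_ord2 !mxE.
rewrite -(mulmx1C UU); apply/matrixP => i j.
by rewrite mxE !ketbraE mxE sum_ord2 !mxE.
Qed.

Lemma channel_prepare {R : realType} (k : 'cV[R[i]]_2) :
  (adjmx k *m k) 0 0 = 1 -> is_channel (fun X => \tr X *: ketbra k k).
Proof.
move=> k1; split=> [|X]; first exact: cp_trace_ketbra.
by rewrite mxtraceZ mxtrace_ketbra_unit// mulr1.
Qed.

Lemma cp_project {R : realType} (k : 'cV[R[i]]_2) :
  completely_positive (fun X => ketbra k k *m X *m ketbra k k).
Proof. by have := cp_conj (ketbra k k); rewrite adjmx_ketbra. Qed.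

Lemma protocol_do_nothing {R : realType} (p : R) : 0 <= p -> p <= 1 ->
  is_protocol (fun X : op R => p%:C *: X) (fun X => (1 - p)%:C *: X) id id.
Proof.
move=> p0 p1; split; last by split; exact: channel_id.
split; first exact: cp_scale.
split; first by apply: cp_scale; rewrite subr_ge0.
by move=> X; rewrite -scalerDl -rmorphD /= addrC subrK scale1r.
Qed.

Lemma protocol_discriminate {R : realType} (k1 k2 : 'cV[R[i]]_2) :
  orthonormal2 k1 k2 ->
  is_protocol (fun X => ketbra k1 k1 *m X *m ketbra k1 k1)
    (fun X => ketbra k2 k2 *m X *m ketbra k2 k2)
    (fun X => \tr X *: ketbra k1 k1) (fun X => \tr X *: ketbra k2 k2).
Proof.
move=> on; have [n1 [n2 _]] := on.
split; last by split; exact: channel_prepare.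
split; first exact: cp_project.
split=> [|X]; first exact: cp_project.
(* By cyclicity tr(P X P) = tr(P X), and the two projectors sum to 1. *)
rewrite mxtraceD mxtrace_mulC mulmxA ketbra_idem// [X in _ + X]mxtrace_mulC.
rewrite [X in _ + \tr X]mulmxA ketbra_idem// -mxtraceD -mulmxDl.
by rewrite orthonormal2_complete// mul1mx.
Qed.

Lemma supertrace_id {R : realType} : supertrace (id : superop R) = 4%:R.
Proof. by rewrite /supertrace !sum_ord2 !mxE /= -!natrD. Qed.

(** Here s = 4 and t = 2, so the bounds on [s] and [s + t] are attained. *)
Lemma avg_fidelity_do_nothing {R : realType} (eps p : R) : 0 <= p -> p <= 1 ->
  avg_fidelity eps (fun X : op R => p%:C *: X) (fun X => (1 - p)%:C *: X) id id
    = 1 - eps / 2.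
Proof.
move=> p0 p1; rewrite avg_fidelityE; last exact: protocol_do_nothing.
rewrite !supertraceZ -mulrDl -mxtraceD -scalerDl -rmorphD /= addrC [p + _]addrC subrK.
by rewrite mul1r scale1r mxtrace1 supertrace_id !Re_nat; field.
Qed.

Lemma supertrace_discriminate {R : realType} (k : 'cV[R[i]]_2) :
  (adjmx k *m k) 0 0 = 1 ->
  supertrace (fun X => \tr (ketbra k k *m X *m ketbra k k) *: ketbra k k) = 1.
Proof.
move=> k1; have [lI _] := cp_project k.
rewrite (supertrace_measure_prepare
  (m := fun X => \tr (ketbra k k *m X *m ketbra k k))) => [|a X Y].
  by rewrite !ketbra_idem// mxtrace_ketbra_unit.
by rewrite lI mxtraceD mxtraceZ.
Qed.

(** Here s = 2 and t = 4, so the bounds on [t] and [s + t] are attained and [eps] cancels. *)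
Lemma avg_fidelity_discriminate {R : realType} (eps : R) (k1 k2 : 'cV[R[i]]_2) :
  orthonormal2 k1 k2 ->
  avg_fidelity eps (fun X => ketbra k1 k1 *m X *m ketbra k1 k1)
    (fun X => ketbra k2 k2 *m X *m ketbra k2 k2)
    (fun X => \tr X *: ketbra k1 k1) (fun X => \tr X *: ketbra k2 k2) = 2 / 3.
Proof.
move=> on; rewrite avg_fidelityE; last exact: protocol_discriminate.
have [n1 [n2 _]] := on; rewrite !supertrace_discriminate// mxtrace1.
rewrite -!scalemxAr -!scalemxAl !ketbra_idem// !mxtraceZ !mxtrace_ketbra_unit//.
by rewrite mulr1 -[1 + 1]/(2%:R : R[i]) -natrD !Re_nat; field.
Qed.

(** * Optimality in the two noise regimes *)

Unset Implicit Arguments.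

Theorem theorem2 (R : realType) (eps : R) (heps0 : 0 <= eps) (heps1 : eps <= 1) :
  (eps <= 2 / 3 ->
     (forall p : R, 0 <= p -> p <= 1 ->
        let I1 : superop R := fun rho => (p%:C : R[i]) *: rho in
        let I2 : superop R := fun rho => ((1 - p)%:C : R[i]) *: rho in
        is_protocol I1 I2 id id /\
        avg_fidelity eps I1 I2 id id = 1 - eps / 2) /\
     (forall I1 I2 C1 C2 : superop R, is_protocol I1 I2 C1 C2 ->
        avg_fidelity eps I1 I2 C1 C2 <= 1 - eps / 2))
  /\
  (2 / 3 <= eps ->
     (forall phi1 phi2 : 'cV[R[i]]_2, orthonormal2 phi1 phi2 ->
        let P1 := ketbra phi1 phi1 in
        let P2 := ketbra phi2 phi2 in
        let I1 : superop R := fun rho => P1 *m rho *m P1 in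
        let I2 : superop R := fun rho => P2 *m rho *m P2 in
        let C1 : superop R := fun rho => \tr rho *: P1 in
        let C2 : superop R := fun rho => \tr rho *: P2 in
        is_protocol I1 I2 C1 C2 /\
        avg_fidelity eps I1 I2 C1 C2 = 2 / 3) /\
     (forall I1 I2 C1 C2 : superop R, is_protocol I1 I2 C1 C2 ->
        avg_fidelity eps I1 I2 C1 C2 <= 2 / 3)).
Proof.
split=> heps; split.
- move=> p p0 p1 I1 I2; split; first exact: protocol_do_nothing.
  exact: avg_fidelity_do_nothing.
- move=> I1 I2 C1 C2 prot; rewrite avg_fidelityE//.
  have [] := protocol_bounds prot; move: (complex.Re _) (complex.Re _) => s t.
  move=> s4 t4 st6; rewrite ler_pdivrMr//.
  (* The objective (1 - eps) s + (eps/2) t is (1 - 3 eps/2) s + (eps/2)(s + t), with nonnegative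
     weights exactly when 0 <= eps <= 2/3. *)
  have h1 : 0 <= (1 - 3 / 2 * eps) * (4 - s) by apply: mulr_ge0; lra.
  have h2 : 0 <= eps / 2 * (6 - (s + t)) by apply: mulr_ge0; lra.
  nra.
- move=> phi1 phi2 on P1 P2 I1 I2 C1 C2; split; first exact: protocol_discriminate.
  exact: avg_fidelity_discriminate.
- move=> I1 I2 C1 C2 prot; rewrite avg_fidelityE//.
  have [] := protocol_bounds prot; move: (complex.Re _) (complex.Re _) => s t.
  move=> s4 t4 st6; rewrite ler_pdivrMr//.
  (* Now the objective is split as (1 - eps)(s + t) + (3 eps/2 - 1) t, with nonnegative weights for
     2/3 <= eps <= 1. *)
  have h1 : 0 <= (1 - eps) * (6 - (s + t)) by apply: mulr_ge0; lra.
  have h2 : 0 <= (3 / 2 * eps - 1) * (4 - t) by apply: mulr_ge0; lra.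
  nra.
Qed.
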